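(* Let $k$ be a positive integer. Then the identity $\sin_k(2t) = 2\sin_k(t)\cos_k(t)$ (for all real $t$) holds if and only if $k = 2$.
   Context: For real $p \ge 1$ put $\pi_p := 2\int_0^1 (1-s^p)^{-\frac{p-1}{p}}\,ds$. On the interval $[0,\pi_p/2]$ the functions $\cos_p t = x(t)$ and $\sin_p t = y(t)$ are the unique nonnegative solution of the initial value problem $x'(t) = -y(t)^{p-1}$, $y'(t) = x(t)^{p-1}$, $x(0)=1$, $y(0)=0$ (with the convention $0^0=1$ when $p=1$; equivalently, $\sin_p$ on $[0,\pi_p/2]$ is the inverse of $y \mapsto \int_0^y (1-s^p)^{-\frac{p-1}{p}}ds$ on $[0,1]$, and $\cos_p t = (1-\sin_p^p t)^{1/p}$). They are extended to all of $\mathbb{R}$ by symmetry and periodicity: $\sin_p t := \sin_p(\pi_p - t)$ for $\pi_p/2 < t \le \pi_p$, $\sin_p t := -\sin_p(2\pi_p - t)$ for $\pi_p < t < 2\pi_p$, and $\sin_p(t + 2\pi_p m) = \sin_p t$ for every integer $m$; similarly $\cos_p t := -\cos_p(\pi_p - t)$ for $\pi_p/2 < t \le \pi_p$, $\cos_p t := \cos_p(2\pi_p - t)$ for $\pi_p < t < 2\pi_p$, and $\cos_p(t+2\pi_p m) = \cos_p t$ for every integer $m$. Here $p=k$. *)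

(* Defs.v *)
From HB Require Import structures.
From mathcomp Require Import all_boot all_order all_algebra.
From mathcomp Require Import all_classical all_reals all_analysis.
Import Order.TTheory GRing.Theory Num.Theory.
Import numFieldNormedType.Exports.

Set Implicit Arguments.
Unset Strict Implicit.
Unset Printing Implicit Defensive.

Local Open Scope classical_set_scope.
Local Open Scope ring_scope.

Section GeneralizedTrig.
Variable R : realType.
Implicit Types (p t : R) (D : set R) (f x y : R -> R).

(* The integrand is unbounded at s = 1 when p > 1; the Lebesgue integral of this
   nonnegative function is the improper integral, and the value 0 that powR
   assigns at the single point s = 1 does not affect it. *)
Definition pip p : R :=
  2 * \int[lebesgue_measure]_(s in `[0%R, 1%R]) (1 - s `^ p) `^ (- ((p - 1) / p)).

(* One-sided at the endpoints when D is a closed interval. *)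
Definition has_deriv_within D f (a l : R) : Prop :=
  (fun u => (f u - f a) / (u - a)) @ within D a^' --> l.

(* powR satisfies 0 `^ 0 = 1, the convention needed for p = 1. *)
Definition trig_ivp p (xy : (R -> R) * (R -> R)) : Prop :=
  let: (x, y) := xy in
  let D := `[0, pip p / 2] in
  [/\ x 0 = 1, y 0 = 0 &
      forall t, t \in D ->
        [/\ 0 <= x t, 0 <= y t,
            has_deriv_within [set` D] x t (- (y t `^ (p - 1))) &
            has_deriv_within [set` D] y t (x t `^ (p - 1))]].

(* The solution is unique only on [0, pip p / 2]; the values of the chosen
   functions elsewhere are arbitrary and are not used below. *)
Definition trig_arc p : (R -> R) * (R -> R) :=
  xget (fun=> 0, fun=> 0) [set xy | trig_ivp p xy].

Definition cosp_arc p : R -> R := (trig_arc p).1.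
Definition sinp_arc p : R -> R := (trig_arc p).2.

(* Representative of t modulo 2 * pip p in [0, 2 * pip p). *)
Definition reduce_period p t : R :=
  t - 2 * pip p * (Num.floor (t / (2 * pip p)))%:~R.

Definition sinp_half p t : R :=
  if t <= pip p / 2 then sinp_arc p t else sinp_arc p (pip p - t).

Definition sinp p t : R :=
  let r := reduce_period p t in
  if r <= pip p then sinp_half p r else - sinp_half p (2 * pip p - r).

Definition cosp_half p t : R :=
  if t <= pip p / 2 then cosp_arc p t else - cosp_arc p (pip p - t).

Definition cosp p t : R :=
  let r := reduce_period p t in
  if r <= pip p then cosp_half p r else cosp_half p (2 * pip p - r).

End GeneralizedTrig.

(* Main.v *)
Require Import Defs.
From HB Require Import structures.
From mathcomp Require Import all_boot all_order all_algebra.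
From mathcomp Require Import all_classical all_reals all_analysis.
From mathcomp Require Import measurable_realfun.
From mathcomp Require Import ring lra.
Import Order.TTheory GRing.Theory Num.Theory.
Import numFieldNormedType.Exports.

(** Write T = pi_k / 2, and let (x, y) = (cos_k, sin_k) on [0, T].

    Suppose that y(2t) = 2 y(t) x(t) on [0, T/2].  Differentiating with the two
    differential equations gives x(2t)^(k-1) = x(t)^k - y(t)^k, and letting t
    tend to T/2, where x(2t) tends to x(T) = 0, it gives
    0^(k-1) = X^k - Y^k for X = x(T/2), Y = y(T/2) ([double_angle_half]).  Two
    more relations are available: X^k + Y^k = 1 ([sol_energy]) and
    2 X Y = y(T) = 1.  For k = 1 they force Y = 0, which contradicts 2 X Y = 1;
    for k >= 2 they force X = Y, X^2 = 1/2 and X^k = 1/2, hence k = 2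
    ([double_angle_exponent]).  No asymptotic expansion is involved: the single
    point T/2 decides.

    This uses x(T) = 0 and y(T) = 1, that is, that T as defined by the integral
    is the time at which the arc reaches the axis ([sol_xT]).  Let
    F(y) = \int_0^y (1 - s^k)^(-(k-1)/k) ds, so that F(1) = T.  As long as x > 0,
    F(y(t)) has derivative 1, so F(y(t)) = t; if x(T) were positive, then
    y(T) < 1 and T = F(y(T)) < F(1) = T.

    Since cos_k and sin_k are chosen among the solutions of the initial value
    problem, existence must be proved as well ([trig_ivp_exists]).  The integral
    defining F converges because 1 - s^p >= 1 - s ([integrable_arcsinp_deriv]);
    the solution is y = F^-1, x = (1 - y^p)^(1/p), and the singular endpoint T is
    handled by the mean value theorem: a function continuous on a segment whose
    derivative inside has a limit at the endpoint is differentiable there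
    ([has_deriv_within_mean]).

    For k = 2, (x - cos)^2 + (y - sin)^2 has derivative 0, so every solution is
    the usual pair (cos, sin) on [0, T].  Then cos T = 0 while cos >= 0 on
    [0, T], so T = pi / 2 ([pip2_pi]), the extensions by symmetry are the usual
    cosine and sine ([sinp2E], [cosp2E]), and the double angle formula is the
    classical one. *)

Set Implicit Arguments.
Unset Strict Implicit.
Unset Printing Implicit Defensive.

Local Open Scope classical_set_scope.
Local Open Scope ring_scope.

(** * Derivatives and continuity on a segment *)

Lemma has_deriv_withinP (R : realType) (D : set R) (f : R -> R) (a l : R) :
  has_deriv_within D f a l <->
  forall e, 0 < e -> exists2 d, 0 < d &
    forall u, D u -> u != a -> `|a - u| < d ->
      `|l - (f u - f a) / (u - a)| < e.
Proof.
split=> [/cvgrPdist_lt fl e e0|fl].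
  have [d /= d0 dP] := fl e e0; exists d => // u Du ua au.
  by apply: dP => //=; rewrite distrC.
apply/cvgrPdist_lt => e e0; have [d d0 dP] := fl e e0.
by exists d => //= u au ua Du; exact: dP.
Qed.

Lemma within_segmentP (R : realType) (a b : R) (f : R -> R) :
  {within `[a, b], continuous f} <->
  forall t, t \in `[a, b] -> forall e, 0 < e -> exists2 d, 0 < d &
    forall u, u \in `[a, b] -> `|t - u| < d -> `|f t - f u| < e.
Proof.
rewrite subspace_continuousP; split=> fc t tab.
  move=> e e0; have /cvgrPdist_lt/(_ e e0)[d /= d0 dP] := fc t tab.
  by exists d => // u uab tu; exact: dP.
apply/cvgrPdist_lt => e e0; have [d d0 dP] := fc t tab e e0.
by exists d => //= u tu uab; exact: dP.
Qed.

(** Near [t] the difference quotients are bounded by |g t| + 1, so the increments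
    of [f] are at most that constant times the distance. *)
Lemma has_deriv_within_continuous (R : realType) (a b : R) (f g : R -> R) :
  (forall t, t \in `[a, b] -> has_deriv_within [set` `[a, b]] f t (g t)) ->
  {within `[a, b], continuous f}.
Proof.
move=> fg; apply/within_segmentP => t tab e e0.
have /has_deriv_withinP/(_ 1 ltr01)[d d0 dP] := fg t tab.
pose M := `|g t| + 1; have M0 : 0 < M by rewrite ltr_wpDl.
exists (Num.min d (e / M)); first by rewrite lt_min d0 divr_gt0.
move=> u uab; rewrite lt_min => /andP[tud tue].
have [->|ut] := eqVneq u t; first by rewrite subrr normr0.
have ut0 : u - t != 0 by rewrite subr_eq0.
have q1 := dP u uab ut tud.
rewrite distrC -[f u - f t](divfK ut0) normrM.
have qM : `|(f u - f t) / (u - t)| < M.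
  rewrite -[X in `|X|](subKr (g t)) (le_lt_trans (ler_normB _ _))//.
  by rewrite ltrD2l.
by rewrite -[ltRHS](divfK (lt0r_neq0 M0)) mulrC ltr_pM// distrC.
Qed.

Lemma has_deriv_within_is_derive (R : realType) (a b : R) (f : R -> R) t l :
  t \in `]a, b[ -> has_deriv_within [set` `[a, b]] f t l -> is_derive t 1 f l.
Proof.
rewrite in_itv/= => /andP[at_ tb] /has_deriv_withinP fl.
suff H : h^-1 *: (f (h *: 1 + t) - f t) @[h --> 0^'] --> l.
  by split; [apply/cvg_ex; exists l|apply/cvg_lim].
apply/cvgrPdist_lt => e e0; have [d d0 dP] := fl e e0.
exists (Num.min d (Num.min (t - a) (b - t))) => /=.
  by rewrite !lt_min d0 !subr_gt0 at_.
move=> h; rewrite /= sub0r normrN !lt_min => /and3P[hd hta hbt] h0.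
have := dP (h + t); rewrite -[(h *: 1)]/(h * 1) mulr1 addrK mulrC; apply.
- rewrite /= in_itv/=; move: hta hbt; rewrite !ltr_norml => /andP[? ?] /andP[? ?].
  by apply/andP; split; lra.
- by rewrite -subr_eq0 addrK.
- by rewrite opprD addrCA subrr addr0 normrN.
Qed.

(** This is what makes the singular endpoints harmless: the derivative inside the
    segment is enough, provided that it extends continuously to the ends, since
    by the mean value theorem every difference quotient is a value of [g] at a
    point at least as close to [t]. *)
Lemma has_deriv_within_mean (R : realType) (a b : R) (f g : R -> R) t :
  (forall t, t \in `]a, b[ -> is_derive t 1 f (g t)) ->
  {within `[a, b], continuous f} -> {within `[a, b], continuous g} ->
  t \in `[a, b] -> has_deriv_within [set` `[a, b]] f t (g t).
Proof.
move=> df cf /within_segmentP cg tab; apply/has_deriv_withinP => e e0.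
have [d d0 dP] := cg t tab e e0; exists d => // u uab ut tu.
suff [c cab [tc ->]] : exists2 c, c \in `[a, b] &
    `|t - c| <= `|t - u| /\ (f u - f t) / (u - t) = g c.
  by apply: dP => //; exact: le_lt_trans tu.
have ut0 : u - t != 0 by rewrite subr_eq0.
move: tab uab; rewrite /= !in_itv/= => /andP[a_t tb] /andP[au ub].
have mvt (x y : R) : a <= x -> x < y -> y <= b ->
    exists2 c, c \in `]x, y[ & f y - f x = g c * (y - x).
  move=> ax xy yb.
  have dfxy z : z \in `]x, y[ -> is_derive z 1 f (g z).
    rewrite in_itv/= => /andP[xz zy]; apply: df; rewrite in_itv/=.
    by rewrite (le_lt_trans ax)// (lt_le_trans zy).
  have cfxy : {within `[x, y], continuous f}.
    by apply: continuous_subspaceW cf; apply: subset_itv; rewrite bnd_simp.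
  exact: (MVT xy dfxy cfxy).
have [tu'|ut'|tu'] := ltgtP t u; last by rewrite tu' eqxx in ut.
- have [c + ->] := mvt t u a_t tu' ub; rewrite in_itv/= => /andP[tc cu].
  exists c; first by rewrite in_itv/=; apply/andP; split; lra.
  by split; [rewrite !ltr0_norm; lra|rewrite mulfK].
- have [c + E] := mvt u t au ut' tb; rewrite in_itv/= => /andP[tc cu].
  exists c; first by rewrite in_itv/=; apply/andP; split; lra.
  split; first by rewrite !gtr0_norm; lra.
  by apply: (mulIf ut0); rewrite divfK// -opprB E -mulrN opprB.
Qed.

Lemma within_segment_comp (R : realType) (a b c d : R) (f g : R -> R) :
  {within `[c, d], continuous g} -> {within `[a, b], continuous f} ->
  (forall t, t \in `[a, b] -> f t \in `[c, d]) ->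
  {within `[a, b], continuous (g \o f)}.
Proof.
move=> /within_segmentP cg /within_segmentP cf fcd.
apply/within_segmentP => t tab e e0.
have [d1 d10 d1P] := cg _ (fcd t tab) e e0.
have [d2 d20 d2P] := cf t tab d1 d10.
by exists d2 => // u uab tu /=; apply: d1P; [exact: fcd|exact: d2P].
Qed.

(** Where [f] vanishes, [powR] need not be continuous from the left (it is 1 on
    negative numbers), so continuity there comes from monotonicity on the
    nonnegative half-line instead. *)
Lemma within_segment_powR (R : realType) (a b r : R) (f : R -> R) : 0 <= r ->
  (forall t, t \in `[a, b] -> 0 <= f t) -> {within `[a, b], continuous f} ->
  {within `[a, b], continuous (fun t => f t `^ r)}.
Proof.
rewrite le_eqVlt => /orP[/eqP <- _ _|r0 f0 /within_segmentP cf].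
  apply/within_segmentP => t _ e e0; exists 1 => // u _ _.
  by rewrite !powRr0 subrr normr0.
apply/within_segmentP => t tab e e0.
have := f0 t tab; rewrite le_eqVlt => /orP[/eqP ft|ft].
  (* The radius e^(1/r) is the preimage of e under the power r. *)
  rewrite -ft; have [d d0 dP] := cf t tab (e `^ r^-1) (powR_gt0 _ e0).
  exists d => // u uab /(dP u uab); rewrite -ft powR0 ?gt_eqF// !sub0r !normrN.
  rewrite ger0_norm ?f0// ger0_norm ?powR_ge0// => fu.
  have := gt0_ltr_powR r0 (f0 u uab) (powR_ge0 _ _) fu.
  by rewrite -powRrM mulVf ?gt_eqF// powRr1// ltW.
have c : {for f t, continuous (fun v : R => v `^ r)}.
  apply/differentiable_continuous/derivable1_diffP.
  exact: (@ex_derive _ _ _ _ _ _ _ (is_derive1_powR r ft)).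
move/cvgrPdist_lt: c => /(_ e e0)[d1 /= d10 d1P].
have [d d0 dP] := cf t tab d1 d10.
by exists d => // u uab tu; apply: d1P; exact: dP.
Qed.

Lemma is_derive0_segment (R : realType) (a b : R) (f : R -> R) :
  (forall t, t \in `]a, b[ -> is_derive t 1 f 0) ->
  {within `[a, b], continuous f} -> {in `[a, b], forall t, f t = f a}.
Proof.
move=> df cf t; rewrite in_itv/= => /andP[at_ tb].
have dft z : z \in `]a, t[ -> is_derive z 1 f 0.
  rewrite in_itv/= => /andP[az zt]; apply: df; rewrite in_itv/= az/=.
  exact: lt_le_trans tb.
have cft : {within `[a, t], continuous f}.
  by apply: continuous_subspaceW cf; apply: subset_itv; rewrite bnd_simp.
have [c _ E] := @MVT_segment _ f (fun=> 0) a t at_ dft cft.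
by apply/eqP; rewrite -subr_eq0 E mul0r.
Qed.

Lemma within_segment_exprn (R : realType) (a b : R) (f : R -> R) m :
  {within `[a, b], continuous f} ->
  {within `[a, b], continuous (fun t => f t ^+ m)}.
Proof.
move=> /subspace_continuousP cf; apply/subspace_continuousP => t tab.
have cm : {for f t, continuous (fun v : R => v ^+ m)} by exact: exprn_continuous.
exact: continuous_cvg cm (cf t tab).
Qed.

Lemma is_derive_exprn (R : realType) (f : R -> R) (t l : R) m :
  is_derive t 1 f l ->
  is_derive t 1 (fun u => f u ^+ m.+1) (m.+1%:R * f t ^+ m * l).
Proof.
move=> d; have := is_deriveX m.+1 d.
rewrite (_ : f ^+ m.+1 = fun u => f u ^+ m.+1); first exact.
by apply/funext => u; rewrite fctE.
Qed.

Lemma within_segment_eq0_right (R : realType) (a b : R) (h : R -> R) : a < b ->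
  {within `[a, b], continuous h} -> {in `]a, b[, forall t, h t = 0} -> h b = 0.
Proof.
move=> ab /within_segmentP ch h0; apply/eqP; rewrite -normr_eq0 eq_le normr_ge0.
rewrite andbT leNgt; apply/negP => hb0.
have bb : b \in `[a, b] by rewrite in_itv/= lexx ltW.
have [d d0 dP] := ch b bb _ hb0.
pose u := Num.max ((a + b) / 2) (b - d / 2).
have au : a < u by rewrite lt_max; apply/orP; left; lra.
have ub : u < b by rewrite gt_max; apply/andP; split; lra.
have bu : b - d / 2 <= u by rewrite le_max lexx orbT.
have uab : u \in `]a, b[ by rewrite in_itv/= au.
suff : `|h b - h u| < `|h b| by rewrite (h0 u uab) subr0 ltxx.
by apply: dP; [exact: subset_itv_oo_cc|rewrite gtr0_norm; lra].
Qed.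

Lemma is_derive_uniq (R : realType) (f : R -> R) (t l m : R) :
  is_derive t 1 f l -> is_derive t 1 f m -> l = m.
Proof. by move=> [_ <-] [_ <-]. Qed.

(** * The arc length integral *)

Definition arcsinp_deriv (R : realType) (p s : R) : R :=
  (1 - s `^ p) `^ (- ((p - 1) / p)).

(** The inverse function of sin_p on [0, 1]; its value at 1 is half of pi_p. *)
Definition arcsinp (R : realType) (p y : R) : R :=
  \int[lebesgue_measure]_(s in `[0, y]) arcsinp_deriv p s.

Lemma measurable_arcsinp_deriv (R : realType) (p : R) (D : set R) :
  measurable_fun D (arcsinp_deriv p).
Proof.
apply: (measurable_funS measurableT) => //.
apply: (measurableT_comp (measurable_powR _)).
by apply: measurable_funB => //; exact: measurable_powR.
Qed.

Lemma arcsinp_deriv_ge0 (R : realType) (p s : R) : 0 <= arcsinp_deriv p s.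
Proof. exact: powR_ge0. Qed.

Lemma powR_lt1 (R : realType) (p s : R) : 0 < p -> 0 <= s < 1 -> s `^ p < 1.
Proof.
move=> p0 /andP[s0 s1].
by have := gt0_ltr_powR p0 s0 (ler01 : 1 \in Num.nneg) s1; rewrite powR1.
Qed.

Lemma arcsinp_deriv_gt0 (R : realType) (p s : R) : 0 < p -> 0 <= s < 1 ->
  0 < arcsinp_deriv p s.
Proof. by move=> p0 s01; rewrite powR_gt0// subr_gt0 powR_lt1. Qed.

Lemma continuous_arcsinp_deriv (R : realType) (p s : R) : 0 < p -> 0 < s < 1 ->
  {for s, continuous (arcsinp_deriv p)}.
Proof.
move=> p0 /andP[s0 s1].
apply/differentiable_continuous/derivable1_diffP.
have sp : 0 < 1 - s `^ p by rewrite subr_gt0 powR_lt1// ltW.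
have d1 := (is_derive1_powR p s0).
have d2 : is_derive s 1 (fun s : R => 1 - s `^ p) (0 - p * s `^ (p - 1)).
  by apply: is_deriveB.
have d3 := is_derive1_powR (- ((p - 1) / p)) sp.
have d4 := @is_derive1_comp _ (fun u : R => u `^ _) (fun s : R => 1 - s `^ p)
  _ _ _ d3 d2.
exact: (@ex_derive _ _ _ _ _ _ _ d4).
Qed.

(** Since s <= 1 and p >= 1, s^p <= s, hence 1 - s^p >= 1 - s; the exponent being
    nonpositive, the inequality reverses.  The majorant has an explicit
    primitive. *)
Lemma arcsinp_deriv_le (R : realType) (p s : R) : 1 <= p -> 0 <= s < 1 ->
  arcsinp_deriv p s <= (1 - s) `^ (p^-1 - 1).
Proof.
move=> p1 /andP[s0 s1]; have p0 := lt_le_trans ltr01 p1.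
have -> : p^-1 - 1 = - ((p - 1) / p) by field; rewrite lt0r_neq0.
rewrite /arcsinp_deriv !powRN lef_pV2 ?posrE ?powR_gt0 ?subr_gt0 ?powR_lt1 ?s0//.
apply: ge0_ler_powR; rewrite ?nnegrE ?subr_ge0 ?(ltW s1)//.
- by rewrite divr_ge0 ?subr_ge0// ltW.
- by rewrite ltW// powR_lt1// s0.
- rewrite lerD2l lerN2; have [->|s0'] := eqVneq s 0; first by rewrite powR0// gt_eqF.
  by apply: ge1r_powR => //; rewrite (ltW s1) lt_def s0' s0.
Qed.

(** A primitive is -p (1 - s)^(1/p), which stays between -p and 0: the bound is
    uniform in [c]. *)
Lemma integral_powR_onem_le (R : realType) (p c : R) : 1 <= p -> 0 <= c < 1 ->
  (\int[lebesgue_measure]_(s in `[0%R, c]) ((1 - s) `^ (p^-1 - 1))%:E <= p%:E)%E.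
Proof.
move=> p1; have p0 := lt_le_trans ltr01 p1.
rewrite le_eqVlt => /andP[/orP[/eqP <- _|c0 c1]].
  by rewrite set_itv1 integral_set1 lee_fin ltW.
pose H s : R := - p * (1 - s) `^ p^-1.
have dpow (r s : R) : s < 1 -> is_derive s 1 (fun s : R => (1 - s) `^ r)
    (- (r * (1 - s) `^ (r - 1))).
  move=> s1; have d1 : is_derive s 1 (fun s : R => 1 - s) (0 - 1).
    by apply: is_deriveB.
  have s1' : 0 < 1 - s by rewrite subr_gt0.
  have := @is_derive1_comp _ (fun u : R => u `^ r) (fun s : R => 1 - s) _ _ _
    (is_derive1_powR r s1') d1.
  by move=> /is_derive_eq; apply; rewrite sub0r mulrN1.
have dH (s : R) : s < 1 -> is_derive s 1 H ((1 - s) `^ (p^-1 - 1)).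
  move=> s1; have := is_deriveZ (- p) (dpow p^-1 _ s1).
  move=> /is_derive_eq; apply; rewrite -[LHS]/(_ * _).
  by rewrite mulrNN mulrA divff ?mul1r// lt0r_neq0.
have ch (s : R) : s < 1 -> {for s, continuous 
    (fun s : R => (1 - s) `^ (p^-1 - 1))}.
  by move=> s1; apply/differentiable_continuous/derivable1_diffP;
     apply: (@ex_derive _ _ _ _ _ _ _ (dpow _ _ s1)).
have cH (s : R) : s < 1 -> {for s, continuous H}.
  by move=> s1; apply/differentiable_continuous/derivable1_diffP;
     apply: (@ex_derive _ _ _ _ _ _ _ (dH _ s1)).
rewrite (@continuous_FTC2 _ _ H) //.
- rewrite -EFinB lee_fin /H subr0 powR1 mulr1 mulNr opprK gerDr oppr_le0.
  by rewrite mulr_ge0 ?powR_ge0// ltW.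
- apply: continuous_in_subspaceT => s; rewrite inE/= in_itv/= => /andP[_ sc].
  by apply: ch; exact: le_lt_trans c1.
- split.
  + move=> s; rewrite in_itv/= => /andP[_ sc].
    exact: (@ex_derive _ _ _ _ _ _ _ (dH _ (lt_trans sc c1))).
  + by apply: cvg_at_right_filter; apply: cH.
  + by apply: cvg_at_left_filter; apply: cH.
- move=> s; rewrite in_itv/= => /andP[_ sc]; rewrite derive1E.
  exact: (@derive_val _ _ _ _ _ _ _ (dH _ (lt_trans sc c1))).
Qed.

(** The half-open segment is the increasing union of the segments
    [0, 1 - 1/(i+1)], on which the integrals are at most p; monotone convergence
    gives the same bound on the whole. *)
Lemma integrable_arcsinp_deriv (R : realType) (p : R) : 1 <= p ->
  lebesgue_measure.-integrable `[(0:R), 1] (EFin \o arcsinp_deriv p).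
Proof.
move=> p1; have p0 := lt_le_trans ltr01 p1.
apply/integrableP; split.
  by apply/measurable_EFinP; exact: measurable_arcsinp_deriv.
under eq_integral do rewrite /= ger0_norm ?arcsinp_deriv_ge0//.
rewrite -integral_itv_bndo_bndc; last first.
  by apply/measurable_EFinP; exact: measurable_arcsinp_deriv.
pose S (i : nat) : set R := [set` `[0, 1 - i.+1%:R^-1]].
have SE : [set` `[(0:R), 1[] = \bigcup_i S i.
  apply/seteqP; split=> s /=.
    rewrite in_itv/= => /andP[s0 s1].
    have s1' : 0 < 1 - s by rewrite subr_gt0.
    have [i _ iP] := near_infty_natSinv_lt (PosNum s1').
    exists i => //; rewrite /S /= in_itv/= s0/=.
    by rewrite lerBrDr -lerBrDl ltW//; exact: (iP i (leqnn _)).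
  move=> [i _]; rewrite /S/= !in_itv/= => /andP[-> sc]/=.
  by rewrite (le_lt_trans sc)// ltrBlDr ltrDl invr_gt0.
rewrite SE; apply: (@le_lt_trans _ _ p%:E); last exact: ltry.
have nS : nondecreasing_seq S.
  move=> m n mn; rewrite subsetEset; apply: subset_itvl; rewrite bnd_simp.
  by rewrite lerD2l lerN2 lef_pV2 ?posrE// ler_nat.
have H : (\int[lebesgue_measure]_(s in S i) (arcsinp_deriv p s)%:E @[i --> \oo]
    --> \int[lebesgue_measure]_(s in \bigcup_i S i) (arcsinp_deriv p s)%:E)%E.
  apply: ge0_nondecreasing_set_cvg_integral => //.
  - by move=> i; apply: measurable_itv.
  - by move=> i; apply/measurable_EFinP; exact: measurable_arcsinp_deriv.
  - by move=> i s _; rewrite lee_fin arcsinp_deriv_ge0.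
rewrite -(cvg_lim _ H)//; apply: lime_le; first by apply/cvg_ex; eexists; exact: H.
apply: nearW => i.
apply: le_trans (@integral_powR_onem_le _ p (1 - i.+1%:R^-1) p1 _); last first.
  by rewrite subr_ge0 invf_le1// ler1n/= ltrBlDr ltrDl invr_gt0.
apply: ge0_le_integral.
- exact: measurable_itv.
- by move=> s _; rewrite lee_fin arcsinp_deriv_ge0.
- by apply/measurable_EFinP; exact: measurable_arcsinp_deriv.
- apply/measurable_EFinP; apply: (measurable_funS measurableT) => //.
  by apply: (measurableT_comp (measurable_powR _)); exact: measurable_funB.
- move=> s; rewrite /S/= in_itv/= => /andP[s0 sc]; rewrite lee_fin.
  apply: arcsinp_deriv_le => //; rewrite s0/=.
  by rewrite (le_lt_trans sc)// ltrBlDr ltrDl invr_gt0.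
Qed.

Lemma arcsinp0 (R : realType) (p : R) : arcsinp p 0 = 0.
Proof. by rewrite /arcsinp set_itv1 Rintegral_set1. Qed.

Lemma arcsinp1 (R : realType) (p : R) : arcsinp p 1 = pip p / 2.
Proof. by rewrite /pip mulrAC divff ?mul1r. Qed.

Lemma arcsinp_continuous (R : realType) (p : R) : 1 <= p ->
  {within `[0, 1], continuous (arcsinp p)}.
Proof.
by move=> p1; exact: parameterized_integral_continuous ler01
  (integrable_arcsinp_deriv p1).
Qed.

Lemma is_derive_arcsinp (R : realType) (p s : R) : 1 <= p -> s \in `]0, 1[ ->
  is_derive s 1 (arcsinp p) (arcsinp_deriv p s).
Proof.
move=> p1; rewrite in_itv/= => /andP[s0 s1].
have p0 := lt_le_trans ltr01 p1.
have s01 : 0 < s < 1 by rewrite s0.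
have [|d1 d2] := @continuous_FTC1 R (arcsinp_deriv p) (BLeft 0) s 1 s1
  (integrable_arcsinp_deriv p1) _ (continuous_arcsinp_deriv p0 s01).
  by rewrite lte_fin.
by split; [exact: d1|rewrite -derive1E; exact: d2].
Qed.

Lemma arcsinp_lt (R : realType) (p : R) : 1 <= p ->
  {in `[0, 1] &, {homo arcsinp p : x y / x < y}}.
Proof.
move=> p1; have p0 := lt_le_trans ltr01 p1.
apply: gtr0_derive1_lt_cc; last exact: arcsinp_continuous.
  by move=> s s01; apply: ex_derive; exact: is_derive_arcsinp.
move=> s s01; have d := is_derive_arcsinp p1 s01.
rewrite derive1E derive_val arcsinp_deriv_gt0//.
by move: s01; rewrite in_itv/= => /andP[/ltW -> ->].
Qed.

Lemma pip_gt0 (R : realType) (p : R) : 1 <= p -> 0 < pip p.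
Proof.
move=> p1; have := @arcsinp_lt _ _ p1 0 1; rewrite arcsinp0 arcsinp1.
rewrite !in_itv/= !lexx ler01 ltr01 => /(_ isT isT isT).
by rewrite pmulr_lgt0 ?invr_gt0.
Qed.

(** * Existence of a solution *)

Section Existence.
Variables (R : realType) (p : R).
Hypothesis p1 : 1 <= p.

Let p0 : 0 < p. Proof. exact: lt_le_trans p1. Qed.
Let T : R := pip p / 2.
(** The inverse function of [arcsinp p] on [0, 1]. *)
Let y (t : R) : R := xget 0 [set s | s \in `[0, 1] /\ arcsinp p s = t].
Let x (t : R) : R := (1 - y t `^ p) `^ p^-1.

Let T0 : 0 < T. Proof. by rewrite divr_gt0// pip_gt0. Qed.

Let yK : {in `[0, 1], cancel (arcsinp p) y}.
Proof.
move=> s s01; rewrite /y; case: xgetP => [s' _ /= [s'01 Fs]|/(_ s)]; last first.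
  by case.
have [lt|lt|//] := ltgtP s s'.
  by have := arcsinp_lt p1 s01 s'01 lt; rewrite Fs ltxx.
by have := arcsinp_lt p1 s'01 s01 lt; rewrite Fs ltxx.
Qed.

Let yP (t : R) : t \in `[0, T] -> y t \in `[0, 1] /\ arcsinp p (y t) = t.
Proof.
move=> tT.
have [|s s01 Fs] := @IVT _ (arcsinp p) 0 1 t ler01 (arcsinp_continuous p1).
  move: tT; rewrite in_itv/= => tT.
  by rewrite arcsinp0 arcsinp1 -/T min_l ?max_r// ltW.
by rewrite -{2}Fs -Fs yK.
Qed.

Let y_continuous : {within `[0, T], continuous y}.
Proof.
have := segment_can_le_continuous ler01 (arcsinp_continuous p1) yK.
by rewrite arcsinp0 arcsinp1.
Qed.

Let y_oo (t : R) : t \in `]0, T[ -> y t \in `]0, 1[.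
Proof.
move=> tT; have [|] := @yP t; first exact: subset_itv_oo_cc tT.
rewrite !in_itv/= !le_eqVlt => /andP[/orP[/eqP <-|y0]].
  by rewrite arcsinp0 => _ t0; move: tT; rewrite in_itv/= -t0 ltxx.
move=> /orP[/eqP ->|y1]; last by rewrite y0 y1.
by rewrite arcsinp1 -/T => t0; move: tT; rewrite in_itv/= -t0 ltxx andbF.
Qed.

(** The derivative of the inverse function is the inverse of
    (1 - y^p)^(-(p-1)/p), that is, ((1 - y^p)^(1/p))^(p-1). *)
Let y_derive (t : R) : t \in `]0, T[ -> is_derive t 1 y (x t `^ (p - 1)).
Proof.
move=> tT; have y01 := y_oo tT.
have [_ yt] : y t \in `[0, 1] /\ arcsinp p (y t) = t.
  by apply: yP; exact: subset_itv_oo_cc tT.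
have := y01; rewrite in_itv/= => /andP[y0 y1].
have g0 : 0 < arcsinp_deriv p (y t) by rewrite arcsinp_deriv_gt0// y1 ltW.
have := @is_derive_inverse _ (arcsinp p) y (arcsinp_deriv p (y t)) (y t).
rewrite yt => H; apply: (is_derive_eq (H _ _ _ _)).
- near=> s; apply: yK; apply: subset_itv_oo_cc.
  by near: s; exact: near_in_itvoo.
- near=> s; apply/differentiable_continuous/derivable1_diffP.
  have s01 : s \in `]0, 1[ by near: s; exact: near_in_itvoo.
  exact: (@ex_derive _ _ _ _ _ _ _ (is_derive_arcsinp p1 s01)).
- exact: is_derive_arcsinp.
- by rewrite gt_eqF.
- by rewrite /arcsinp_deriv powRN invrK /x -powRrM mulrC.
Unshelve. all: by end_near. Qed.

(** By the chain rule, with Y = y^p, the derivative is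
    - y^(p-1) (1-Y)^(1/p - 1) (1-Y)^((p-1)/p), and the last two exponents add up
    to 0. *)
Let x_derive (t : R) : t \in `]0, T[ -> is_derive t 1 x (- (y t `^ (p - 1))).
Proof.
move=> tT; have := y_oo tT; rewrite in_itv/= => /andP[y0 y1].
have Y1 : 0 < 1 - y t `^ p by rewrite subr_gt0 powR_lt1// y1 ltW.
have d1 := @is_derive1_comp _ (fun u : R => u `^ p) y _ _ _
  (is_derive1_powR p y0) (y_derive tT).
have d2 : is_derive t 1 (fun t : R => 1 - y t `^ p)
    (0 - p * y t `^ (p - 1) * x t `^ (p - 1)).
  by apply: is_deriveB.
have d3 := @is_derive1_comp _ (fun u : R => u `^ p^-1) (fun t => 1 - y t `^ p)
  _ _ _ (is_derive1_powR p^-1 Y1) d2.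
apply: (is_derive_eq d3); rewrite /x -powRrM.
have E : (1 - y t `^ p) `^ (p^-1 - 1) * (1 - y t `^ p) `^ (p^-1 * (p - 1)) = 1.
  rewrite -powRD; last by rewrite (gt_eqF Y1) implybT.
  have -> : p^-1 - 1 + p^-1 * (p - 1) = 0 by field; rewrite gt_eqF.
  exact: powRr0.
move: E; set A := _ `^ (p^-1 - 1); set B := _ `^ (p^-1 * _) => AB1.
rewrite -[in RHS](mulr1 (y t `^ _)) -AB1; field.
by rewrite gt_eqF.
Qed.

Lemma trig_ivp_exists : exists xy, trig_ivp p xy.
Proof.
have y_ge0 t : t \in `[0, T] -> 0 <= y t.
  by move=> /yP[]; rewrite in_itv/= => /andP[].
have Y_le1 t : t \in `[0, T] -> 0 <= 1 - y t `^ p.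
  move=> /yP[]; rewrite in_itv/= subr_ge0 => /andP[y0 y1] _.
  by have := ge0_ler_powR (ltW p0) y0 (ler01 : 1 \in Num.nneg) y1; rewrite powR1.
have x_continuous : {within `[0, T], continuous x}.
  have Y_continuous : {within `[0, T], continuous (fun t => 1 - y t `^ p)}.
    have /subspace_continuousP c := within_segment_powR (ltW p0) y_ge0 y_continuous.
    by apply/subspace_continuousP => t tT; apply: cvgB; [exact: cvg_cst|exact: c].
  by apply: (within_segment_powR _ Y_le1 Y_continuous); rewrite invr_ge0 ltW.
have q0 : 0 <= p - 1 by rewrite subr_ge0.
have y0 : y 0 = 0 by rewrite -[in LHS](arcsinp0 p) yK// in_itv/= lexx ler01.
exists (x, y); split => //.
  by rewrite /x y0 powR0 ?gt_eqF// subr0 powR1.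
move=> t tT; split; [exact: powR_ge0|exact: y_ge0| |].
- apply: (has_deriv_within_mean x_derive x_continuous _ tT).
  have /subspace_continuousP c := within_segment_powR q0 y_ge0 y_continuous.
  by apply/subspace_continuousP => u uT; apply: cvgN; exact: c.
- apply: (has_deriv_within_mean y_derive y_continuous _ tT).
  by apply: within_segment_powR => // u _; exact: powR_ge0.
Qed.

End Existence.

(** * Properties of every solution *)

Lemma natrS_sub1 (R : realType) n : n.+1%:R - 1 = n%:R :> R.
Proof. by rewrite -natr1 addrK. Qed.

Section Solution.
Variables (R : realType) (n : nat) (x y : R -> R).
Let T : R := pip n.+1%:R / 2.
Hypothesis xy_sol : trig_ivp n.+1%:R (x, y).

Lemma half_pip_gt0 : 0 < T.
Proof. by rewrite divr_gt0// pip_gt0// ler1n. Qed.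

Lemma sol_x0 : x 0 = 1. Proof. by case: xy_sol. Qed.

Lemma sol_y0 : y 0 = 0. Proof. by case: xy_sol. Qed.

Lemma sol_x_ge0 (t : R) : t \in `[0, T] -> 0 <= x t.
Proof. by move=> tT; case: xy_sol => _ _ /(_ t tT)[]. Qed.

Lemma sol_y_ge0 (t : R) : t \in `[0, T] -> 0 <= y t.
Proof. by move=> tT; case: xy_sol => _ _ /(_ t tT)[]. Qed.

Lemma sol_x_continuous : {within `[0, T], continuous x}.
Proof.
apply: (@has_deriv_within_continuous _ _ _ _ (fun t => - (y t `^ (n.+1%:R - 1)))).
by move=> t tT; case: xy_sol => _ _ /(_ t tT)[].
Qed.

Lemma sol_y_continuous : {within `[0, T], continuous y}.
Proof.
apply: (@has_deriv_within_continuous _ _ _ _ (fun t => x t `^ (n.+1%:R - 1))).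
by move=> t tT; case: xy_sol => _ _ /(_ t tT)[].
Qed.

Lemma sol_x_derive (t : R) : t \in `]0, T[ -> is_derive t 1 x (- (y t ^+ n)).
Proof.
move=> tT; have tT' := subset_itv_oo_cc tT.
case: xy_sol => _ _ /(_ t tT')[_ y0 dx _].
rewrite -(powR_mulrn n y0) -natrS_sub1.
exact: has_deriv_within_is_derive tT dx.
Qed.

Lemma sol_y_derive (t : R) : t \in `]0, T[ -> is_derive t 1 y (x t ^+ n).
Proof.
move=> tT; have tT' := subset_itv_oo_cc tT.
case: xy_sol => _ _ /(_ t tT')[x0 _ _ dy].
rewrite -(powR_mulrn n x0) -natrS_sub1.
exact: has_deriv_within_is_derive tT dy.
Qed.

(** The two terms of the derivative, k x^(k-1) (-y^(k-1)) and
    k y^(k-1) x^(k-1), cancel. *)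
Lemma sol_energy (t : R) : t \in `[0, T] -> x t ^+ n.+1 + y t ^+ n.+1 = 1.
Proof.
move=> tT; rewrite (@is_derive0_segment _ 0 T
  (fun t => x t ^+ n.+1 + y t ^+ n.+1) _ _ t tT).
- by rewrite sol_x0 sol_y0 expr1n expr0n/= addr0.
- move=> u uT.
  have dx := is_derive_exprn n (sol_x_derive uT).
  have dy := is_derive_exprn n (sol_y_derive uT).
  apply: (is_derive_eq (is_deriveD dx dy)).
  by rewrite mulrN mulrAC addNr.
- have /subspace_continuousP cx := within_segment_exprn (m := n.+1) sol_x_continuous.
  have /subspace_continuousP cy := within_segment_exprn (m := n.+1) sol_y_continuous.
  by apply/subspace_continuousP => u uT; apply: cvgD; [exact: cx|exact: cy].
Qed.

(** If x(T) > 0, then x > 0 and y < 1 on the whole arc, so that [arcsinp] is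
    differentiable along y, with derivative x^(1-k) x^(k-1) = 1.  Hence
    arcsinp(y(T)) = T = arcsinp(1), although y(T) < 1 and [arcsinp] is strictly
    increasing. *)
Lemma sol_xT : x T = 0.
Proof.
have TT : T \in `[0, T] by rewrite in_itv/= lexx ltW// half_pip_gt0.
have T00 : 0 \in `[0, T] by rewrite in_itv/= lexx ltW// half_pip_gt0.
have [xT|xT] := ltP 0 (x T); last by apply/eqP; rewrite eq_le xT sol_x_ge0.
exfalso.
have x_gt0 t : t \in `[0, T] -> 0 < x t.
  move=> tT; apply: (lt_le_trans xT).
  apply: (@ler0_derive1_le_cc _ x 0 T _ _ sol_x_continuous) => //.
  - by move=> u uT; exact: (@ex_derive _ _ _ _ _ _ _ (sol_x_derive uT)).
  - move=> u uT; have d := sol_x_derive uT; rewrite derive1E derive_val oppr_le0.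
    by rewrite exprn_ge0// sol_y_ge0//; exact: subset_itv_oo_cc uT.
  - by move: tT; rewrite in_itv/= => /andP[].
have y_lt1 t : t \in `[0, T] -> y t < 1.
  move=> tT; rewrite ltNge; apply/negP => y1.
  have := sol_energy tT; have := exprn_gt0 n.+1 (x_gt0 t tT).
  by have := exprn_ege1 n.+1 y1; lra.
have y_gt0 t : t \in `]0, T[ -> 0 < y t.
  move=> tT; rewrite -sol_y0.
  apply: (@gtr0_derive1_lt_cc _ y 0 T _ _ sol_y_continuous) => //.
  - by move=> u uT; exact: (@ex_derive _ _ _ _ _ _ _ (sol_y_derive uT)).
  - move=> u uT; have d := sol_y_derive uT; rewrite derive1E derive_val.
    by rewrite exprn_gt0// x_gt0//; exact: subset_itv_oo_cc uT.
  - exact: subset_itv_oo_cc tT.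
  - by move: tT; rewrite in_itv/= => /andP[].
have p1 : 1 <= n.+1%:R :> R by rewrite ler1n.
have y01 t : t \in `[0, T] -> y t \in `[0, 1].
  by move=> tT; rewrite in_itv/= sol_y_ge0// ltW// y_lt1.
have cFy := within_segment_comp (arcsinp_continuous p1) sol_y_continuous y01.
have dFy t : t \in `]0, T[ -> is_derive t 1 (arcsinp n.+1%:R \o y) 1.
  move=> tT; have tT' := subset_itv_oo_cc tT.
  have yt : y t \in `]0, 1[ by rewrite in_itv/= y_gt0//= y_lt1.
  have d := is_derive1_comp (is_derive_arcsinp p1 yt) (sol_y_derive tT).
  apply: (is_derive_eq d).
  rewrite /arcsinp_deriv powR_mulrn ?sol_y_ge0//.
  have -> : 1 - y t ^+ n.+1 = x t `^ n.+1%:R.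
    by rewrite powR_mulrn ?sol_x_ge0// -(sol_energy tT') addrK.
  have qE : n.+1%:R * - (n%:R / n.+1%:R) = - n%:R :> R.
    by rewrite mulrN mulrC divfK.
  rewrite -powRrM natrS_sub1 qE powRN powR_mulrn ?sol_x_ge0//.
  by rewrite mulVf// expf_neq0// gt_eqF// x_gt0.
have [c _] := @MVT_segment _ _ (fun=> 1) 0 T (ltW half_pip_gt0) dFy cFy.
rewrite /= sol_y0 arcsinp0 !subr0 mul1r => FyT.
have := arcsinp_lt p1 (y01 T TT) (_ : 1 \in _) (y_lt1 T TT).
by rewrite FyT arcsinp1 ltxx in_itv/= lexx ler01 => /(_ isT).
Qed.

Lemma sol_yT : y T = 1.
Proof.
have TT : T \in `[0, T] by rewrite in_itv/= lexx ltW// half_pip_gt0.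
have := sol_energy TT; rewrite sol_xT expr0n/= add0r => /eqP.
by rewrite (pexpr_eq1 (ltn0Sn n) (sol_y_ge0 TT)) => /eqP.
Qed.

End Solution.

(** * The double angle identity forces the exponent 2 *)

Section DoubleAngle.
Variables (R : realType) (n : nat) (x y : R -> R).
Let T : R := pip n.+1%:R / 2.
Hypothesis xy_sol : trig_ivp n.+1%:R (x, y).
Hypothesis double : {in `[0, T / 2], forall t, y (2 * t) = 2 * y t * x t}.

Let T0 : 0 < T. Proof. exact: half_pip_gt0. Qed.

Let half_mul2 : 2 * (T / 2) = T. Proof. by rewrite mulrC divfK. Qed.

(** Half the derivative of each side of the identity. *)
Lemma double_angle_derive t : t \in `]0, T / 2[ ->
  x (2 * t) ^+ n = x t ^+ n.+1 - y t ^+ n.+1.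
Proof.
move=> tT2; have := tT2; rewrite in_itv/= => /andP[t0 tT].
have t2T : 2 * t \in `]0, T[ by rewrite in_itv/=; apply/andP; split; lra.
have tT' : t \in `]0, T[ by rewrite in_itv/=; apply/andP; split; lra.
have d2 : is_derive t 1 (fun u : R => 2 * u) 2.
  by apply: (is_derive_eq (is_deriveZ 2 (is_derive_id t 1))); exact: mulr1.
have dl := @is_derive1_comp _ y (fun u : R => 2 * u) _ _ _
  (sol_y_derive xy_sol t2T) d2.
have dr := is_deriveZ 2 (is_deriveM (sol_y_derive xy_sol tT')
  (sol_x_derive xy_sol tT')).
have dr' : is_derive t 1 (y \o (fun u : R => 2 * u))
    (2 * (y t * (- y t ^+ n) + x t * x t ^+ n)).
  apply: near_eq_is_derive dr; near=> u.
  rewrite /= double; first by rewrite -mulrA.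
  by apply: subset_itv_oo_cc; near: u; exact: near_in_itvoo.
have := is_derive_uniq dl dr'; rewrite !exprS; lra.
Unshelve. all: by end_near. Qed.

(** The limit of the differentiated identity at T/2, where x(2t) tends to
    x(T) = 0. *)
Lemma double_angle_half : 0 ^+ n = x (T / 2) ^+ n.+1 - y (T / 2) ^+ n.+1.
Proof.
have sub : `[0, T / 2] `<=` `[0, T].
  move=> u /=; rewrite !in_itv/= => /andP[u0 uT].
  by have := T0; rewrite u0/=; lra.
have cx : {within `[0, T / 2], continuous x}.
  exact: continuous_subspaceW sub (sol_x_continuous xy_sol).
have cy : {within `[0, T / 2], continuous y}.
  exact: continuous_subspaceW sub (sol_y_continuous xy_sol).
have c2 : {within `[0, T / 2], continuous (fun t : R => 2 * t)}.
  by apply: continuous_subspaceT => t; exact: mulrl_continuous.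
have cx2 : {within `[0, T / 2], continuous (fun t => x (2 * t))}.
  apply: (within_segment_comp (sol_x_continuous xy_sol) c2) => t.
  by rewrite !in_itv/= => /andP[? ?]; apply/andP; split; rewrite -/T; lra.
have /subspace_continuousP c1 := within_segment_exprn (m := n) cx2.
have /subspace_continuousP c3 := within_segment_exprn (m := n.+1) cx.
have /subspace_continuousP c4 := within_segment_exprn (m := n.+1) cy.
have T20 : 0 < T / 2 by rewrite divr_gt0.
have := @within_segment_eq0_right _ 0 (T / 2)
  (fun t => x (2 * t) ^+ n - (x t ^+ n.+1 - y t ^+ n.+1)) T20.
rewrite /= half_mul2 (sol_xT xy_sol) => H; apply/eqP; rewrite -subr_eq0; apply/eqP.
apply: H => [|t tT]; last by rewrite double_angle_derive// subrr.
apply/subspace_continuousP => t tT; apply: cvgB; first exact: c1.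
by apply: cvgB; [exact: c3|exact: c4].
Qed.

(** With X = x(T/2) and Y = y(T/2) there are three equations: X^k + Y^k = 1,
    X^k - Y^k = 0^(k-1) and 2 X Y = 1. *)
Lemma double_angle_exponent : n = 1%N.
Proof.
have tT : T / 2 \in `[0, T / 2] by rewrite in_itv/= lexx andbT divr_ge0// ltW.
have tT' : T / 2 \in `[0, T] by rewrite in_itv/=; apply/andP; split; have := T0; lra.
have := double tT; rewrite half_mul2 (sol_yT xy_sol).
have := sol_energy xy_sol tT'; have := double_angle_half.
move: (sol_x_ge0 xy_sol tT') (sol_y_ge0 xy_sol tT').
set X := x _; set Y := y _ => X0 Y0.
case: n => [|[//|m]].
  (* k = 1: the convention 0^0 = 1 gives X - Y = 1 = X + Y. *)
  rewrite !expr0 !expr1 => half energy.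
  have -> : Y = 0 by lra.
  by rewrite mulr0 mul0r => /eqP; rewrite oner_eq0.
(* k = m + 3: X = Y and X^2 = X^k = 1/2 force X^(m+1) = 1, so X = 1. *)
rewrite [0 ^+ _]expr0n/= => /esym/eqP; rewrite subr_eq0 eqrXn2// => /eqP <-.
move=> energy dbl; exfalso.
have X2 : X ^+ 2 = 2^-1 by rewrite expr2; lra.
have : X ^+ 2 * X ^+ m.+1 = 2^-1 by rewrite -exprD addSn add1n; lra.
rewrite X2 => e3; have : X ^+ m.+1 = 1 by lra.
move=> /eqP; rewrite pexpr_eq1// => /eqP X1.
by move: X2; rewrite X1 expr1n; lra.
Qed.

End DoubleAngle.

(** * The generalized functions in terms of the chosen arc *)

(** The chosen pair does solve the problem, as a solution exists. *)
Lemma trig_arc_sol (R : realType) (p : R) : 1 <= p ->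
  trig_ivp p (cosp_arc p, sinp_arc p).
Proof.
move=> p1; have := xgetPex (fun=> 0, fun=> 0) (trig_ivp_exists p1).
by rewrite /cosp_arc /sinp_arc /trig_arc; case: (xget _ _).
Qed.

Lemma reduce_period_id (R : realType) (p t : R) : 0 <= t < 2 * pip p ->
  reduce_period p t = t.
Proof.
move=> /andP[t0 tp]; have P0 := le_lt_trans t0 tp.
rewrite /reduce_period (_ : Num.floor _ = 0) ?mulr0 ?subr0//.
by apply: floor_def; rewrite add0r divr_ge0 ?(ltW P0)//= ltr_pdivrMr// mul1r.
Qed.

Lemma sinp_arcE (R : realType) (p t : R) : 0 < pip p -> t \in `[0, pip p / 2] ->
  sinp p t = sinp_arc p t.
Proof.
rewrite in_itv/= => P0 /andP[t0 tT].
have tp : t <= pip p by lra.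
rewrite /sinp reduce_period_id; last by apply/andP; split; lra.
by rewrite tp /sinp_half tT.
Qed.

Lemma cosp_arcE (R : realType) (p t : R) : 0 < pip p -> t \in `[0, pip p / 2] ->
  cosp p t = cosp_arc p t.
Proof.
rewrite in_itv/= => P0 /andP[t0 tT].
have tp : t <= pip p by lra.
rewrite /cosp reduce_period_id; last by apply/andP; split; lra.
by rewrite tp /cosp_half tT.
Qed.

(** * The exponent 2: circular functions *)

Section CircularArc.
Variables (R : realType) (x y : R -> R).
Let T : R := pip 2%:R / 2.
Hypothesis xy_sol : trig_ivp 2%:R (x, y).

Let T0 : 0 < T. Proof. exact: half_pip_gt0. Qed.

(** The squared distance between (x, y) and (cos, sin) is constant, because their
    difference solves the same linear rotation equation. *)
Lemma circular_arc t : t \in `[0, T] -> x t = cos t /\ y t = sin t.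
Proof.
move=> tT.
pose D t := (x t - cos t) ^+ 2 + (y t - sin t) ^+ 2.
have Dt : D t = 0.
  rewrite (@is_derive0_segment _ 0 T D _ _ t tT).
  - by rewrite /D (sol_x0 xy_sol) (sol_y0 xy_sol) cos0 sin0 !subrr expr0n addr0.
  - move=> u uT.
    have dx := is_derive_exprn 1
      (is_deriveB (sol_x_derive xy_sol uT) (is_derive_cos u)).
    have dy := is_derive_exprn 1
      (is_deriveB (sol_y_derive xy_sol uT) (is_derive_sin u)).
    apply: (is_derive_eq (is_deriveD dx dy)).
    by rewrite !fctE; ring.
  - have cc : {within `[0, T], continuous (fun t => x t - cos t)}.
      have /subspace_continuousP c := sol_x_continuous xy_sol.
      apply/subspace_continuousP => u uT; apply: cvgB; first exact: c.
      by apply: cvg_within_filter; exact: continuous_cos.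
    have cs : {within `[0, T], continuous (fun t => y t - sin t)}.
      have /subspace_continuousP c := sol_y_continuous xy_sol.
      apply/subspace_continuousP => u uT; apply: cvgB; first exact: c.
      by apply: cvg_within_filter; exact: continuous_sin.
    have /subspace_continuousP c1 := within_segment_exprn (m := 2) cc.
    have /subspace_continuousP c2 := within_segment_exprn (m := 2) cs.
    by apply/subspace_continuousP => u uT; apply: cvgD; [exact: c1|exact: c2].
move/eqP: Dt; rewrite paddr_eq0 ?sqr_ge0// !sqrf_eq0 !subr_eq0.
by move=> /andP[/eqP -> /eqP ->].
Qed.

(** The sign of the cosine locates T: cos T = 0 excludes T < pi / 2, and x >= 0
    on [0, T] excludes T > pi / 2, as cos is negative on ]pi / 2, pi]. *)
Lemma pip2_pi : pip 2%:R = pi :> R.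
Proof.
have TT : T \in `[0, T] by rewrite in_itv/= lexx ltW.
have [cT _] := circular_arc TT; move: cT; rewrite (sol_xT xy_sol) => cT.
have p0 := pi_gt0 R.
suff : T = pi / 2 by rewrite /T; lra.
have [lt|gt|//] := ltgtP T (pi / 2).
  have lo : - (pi / 2) < T by have := T0; lra.
  by have := @cos_gt0_pihalf R T; rewrite lo lt -cT ltxx => /(_ isT).
pose u := Num.min T pi.
have uT : u \in `[0, T].
  by rewrite in_itv/= le_min ge_min lexx/= ltW//= ltW.
have u1 : pi / 2 < u by rewrite lt_min gt/=; lra.
have u2 : u <= pi by rewrite ge_min lexx orbT.
have := sol_x_ge0 xy_sol uT; have [-> _] := circular_arc uT.
rewrite leNgt -[X in _ < X]cos_pihalf ltr_cos ?u1// in_itv/=; apply/andP; split; lra.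
Qed.

End CircularArc.

Lemma sinD_2pi_int (R : realType) (t : R) (m : int) :
  sin (t + 2 * pi * m%:~R) = sin t.
Proof.
have h (k : nat) (u : R) : sin (u + 2 * pi * k%:R) = sin u.
  rewrite -[RHS](periodicn (@sinD2pi R) k) mulr_natr; congr (sin (_ + _ *+ _)).
  by rewrite mulr_natl.
case: m => k; first exact: h.
by rewrite NegzE mulrNz mulrN -(h k.+1 (t - _)) subrK.
Qed.

Lemma cosD_2pi_int (R : realType) (t : R) (m : int) :
  cos (t + 2 * pi * m%:~R) = cos t.
Proof.
have h (k : nat) (u : R) : cos (u + 2 * pi * k%:R) = cos u.
  rewrite -[RHS](periodicn (@cosD2pi R) k) mulr_natr; congr (cos (_ + _ *+ _)).
  by rewrite mulr_natl.
case: m => k; first exact: h.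
by rewrite NegzE mulrNz mulrN -(h k.+1 (t - _)) subrK.
Qed.

Section Two.
Variable R : realType.

Let arc_sol : trig_ivp (2%:R : R) (cosp_arc 2%:R, sinp_arc 2%:R).
Proof. by apply: trig_arc_sol; rewrite ler1n. Qed.

Let pipE : pip 2%:R = pi :> R. Proof. exact: pip2_pi arc_sol. Qed.

Let pi0 : 0 < pi :> R := pi_gt0 R.

Lemma reduce_period2_itv (t : R) : 0 <= reduce_period 2%:R t < 2 * pi.
Proof.
rewrite /reduce_period pipE; set P := 2 * pi.
have P0 : 0 < P by rewrite mulr_gt0.
have := floor_itv (t / P); rewrite ler_pdivlMr// ltr_pdivrMr// intrD.
by move=> /andP[l u]; apply/andP; split; lra.
Qed.

Lemma reduce_period2E (t : R) :
  t = reduce_period 2%:R t + 2 * pi * (Num.floor (t / (2 * pi)))%:~R.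
Proof. by rewrite /reduce_period pipE subrK. Qed.

Lemma sinp_half2 (t : R) : 0 <= t <= pi -> sinp_half 2%:R t = sin t.
Proof.
move=> /andP[t0 tpi]; rewrite /sinp_half pipE; case: ifPn => [tT|].
  by apply: (circular_arc arc_sol _).2; rewrite in_itv/= pipE t0.
rewrite -ltNge => tT.
rewrite (circular_arc arc_sol _).2; last first.
  by rewrite in_itv/= pipE; apply/andP; split; lra.
by rewrite sinB sinpi cospi mul0r mulN1r sub0r opprK.
Qed.

Lemma cosp_half2 (t : R) : 0 <= t <= pi -> cosp_half 2%:R t = cos t.
Proof.
move=> /andP[t0 tpi]; rewrite /cosp_half pipE; case: ifPn => [tT|].
  by apply: (circular_arc arc_sol _).1; rewrite in_itv/= pipE t0.
rewrite -ltNge => tT.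
rewrite (circular_arc arc_sol _).1; last first.
  by rewrite in_itv/= pipE; apply/andP; split; lra.
by rewrite cosB sinpi cospi mul0r mulN1r addr0 opprK.
Qed.

Lemma sinp2E (t : R) : sinp 2%:R t = sin t.
Proof.
rewrite [in RHS](reduce_period2E t) sinD_2pi_int /sinp pipE.
have := reduce_period2_itv t; move: (reduce_period _ _) => r /andP[r0 rpi].
case: ifPn => [rle|]; first by rewrite sinp_half2// r0.
rewrite -ltNge => rgt; rewrite sinp_half2; last by apply/andP; split; lra.
by rewrite mulr_natl sinB sin2pi cos2pi mul0r mul1r sub0r opprK.
Qed.

Lemma cosp2E (t : R) : cosp 2%:R t = cos t.
Proof.
rewrite [in RHS](reduce_period2E t) cosD_2pi_int /cosp pipE.
have := reduce_period2_itv t; move: (reduce_period _ _) => r /andP[r0 rpi].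
case: ifPn => [rle|]; first by rewrite cosp_half2// r0.
rewrite -ltNge => rgt; rewrite cosp_half2; last by apply/andP; split; lra.
by rewrite mulr_natl cosB sin2pi cos2pi mul0r mul1r addr0.
Qed.

End Two.

(** * The characterization *)

Theorem proposition2p4 (R : realType) (k : nat) (hk : (0 < k)%N) :
  (forall t : R,
     sinp k%:R (2 * t) = 2 * sinp k%:R t * cosp k%:R t) <-> k = 2%N.
Proof.
split=> [double|->]; last first.
  move=> t; rewrite !sinp2E cosp2E mulr_natl sin_mulr2n -mulr_natl -mulrA.
  by rewrite (mulrC (cos t)).
case: k hk double => // n _ double.
have p1 : 1 <= n.+1%:R :> R by rewrite ler1n.
have P0 := pip_gt0 p1.
rewrite (double_angle_exponent (trig_arc_sol p1))// => t.
rewrite in_itv/= => /andP[t0 tT].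
have tT' : t \in `[0, pip n.+1%:R / 2] by rewrite in_itv/=; apply/andP; split; lra.
have t2T : 2 * t \in `[0, pip n.+1%:R / 2].
  by rewrite in_itv/=; apply/andP; split; lra.
by have := double t; rewrite !sinp_arcE// cosp_arcE.
Qed.
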